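(* Let $d\ge4$ be an even integer, let $n$ be a power of $d-1$, and let $Q=Q_{n,d}$ be the graph described in the context (a path of $n$ vertices with multiedges, with a tree of depth $\log_{d-1}n$ attached at each end). Let $\psi_Q$ be the $\ell_2$-normalized Perron eigenvector of the adjacency matrix $A_Q$. Then for every vertex $u$ of $Q$ of degree less than $d$, $$\psi_Q(u)=\widetilde O(n^{-5/2}),$$ where $\widetilde O$ suppresses factors polylogarithmic in $n$ and dependence on $d$; i.e. there are constants $C_d$ (depending only on $d$) and $c$ such that $\psi_Q(u)\le C_d(\log n)^{c}\,n^{-5/2}$ for all sufficiently large such $n$.
   Context: Construction of $Q$: start with a path on $n$ vertices in which every two consecutive vertices are joined by $d/2$ parallel edges. At each of the two end vertices of the path attach a rooted tree of depth $\ell=\log_{d-1}n$, whose root is that end vertex: the root has $d/2$ children, every vertex at distance $1,\dots,\ell-1$ from the root has $d-1$ children, and the vertices at distance $\ell$ are leaves (tree edges are single edges). Thus every vertex of $Q$ has degree $d$ except the leaves of the two trees. The Perron eigenvector is the unique strictly positive unit eigenvector for the largest eigenvalue of $A_Q$. *)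

(* Defs.v *)
From HB Require Import structures.
From mathcomp Require Import all_boot all_order all_algebra.
From mathcomp Require Import all_classical all_reals all_analysis.

Set Implicit Arguments.
Unset Strict Implicit.
Unset Printing Implicit Defensive.

Import Order.TTheory GRing.Theory Num.Theory.

(* A finite multigraph on V is given by its edge multiplicities m : V -> V -> nat. *)
Section Multigraph.
Variables (V : finType) (m : V -> V -> nat).

Definition degree (u : V) : nat := \sum_(v : V) m u v.

Definition adjmx (R : pzSemiRingType) : 'M[R]_#|V| :=
  (\matrix_(i, j) (m (enum_val i) (enum_val j))%:R)%R.

End Multigraph.

Section Perron.
Variables (R : realType) (k : nat).
Local Open Scope ring_scope.

Definition largest_eigenvalue (A : 'M[R]_k) (lambda : R) : Prop :=
  eigenvalue A lambda /\ forall mu : R, eigenvalue A mu -> mu <= lambda.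

(* As in [eigenvalue], eigenvectors are row vectors; for a symmetric matrix
   these are the same as column eigenvectors. *)
Definition Perron_eigenvector (A : 'M[R]_k) (psi : 'rV[R]_k) : Prop :=
  [/\ exists2 lambda, largest_eigenvalue A lambda & psi *m A = lambda *: psi,
      forall i, 0 < psi 0 i
    & Num.sqrt (\sum_i psi 0 i ^+ 2) = 1].

End Perron.

Section GraphQ.
Variables (d n ell : nat).

(* A non-root vertex of one of the attached trees is addressed by the sequence
   of choices leading to it from the root: one of d/2 children of the root,
   then a word of length at most ell - 1 over d - 1 letters.  The vertex
   (a, w) is at distance (size w).+1 from the root, so all the distances
   1, ..., ell occur (for 0 < ell). *)
Definition Qbranch : finType := ('I_(d./2) * ell.-1.-bseq 'I_d.-1)%type.

(* [inl i] is the i-th vertex of the path; [inr (b, x)] is the non-root vertex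
   x of the tree attached at the first (b = false) or last (b = true) vertex
   of the path, the roots of the trees being these path vertices. *)
Definition Qvertex : finType := ('I_n + bool * Qbranch)%type.

Definition path_end (b : bool) (i : 'I_n) : bool :=
  if b then i == n.-1 :> nat else i == 0 :> nat.

Definition root_child (x : Qbranch) : bool := size x.2 == 0.

Definition tree_child (x y : Qbranch) : bool :=
  (x.1 == y.1) && [exists c : 'I_d.-1, rcons x.2 c == y.2 :> seq _].

Definition Qmult (u v : Qvertex) : nat :=
  match u, v with
  | inl i, inl j => if (i.+1 == j) || (j.+1 == i) then d./2 else 0
  | inl i, inr (b, x) | inr (b, x), inl i => path_end b i && root_child x
  | inr (b, x), inr (b', y) => (b == b') && (tree_child x y || tree_child y x)
  end.

End GraphQ.

(* Main.v *)
Require Import Defs.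
From HB Require Import structures.
From mathcomp Require Import all_boot all_order all_algebra.
From mathcomp Require Import all_classical all_reals all_analysis.
From mathcomp Require Import ring lra zify.

(* Write p_1, ..., p_n for the values of the positive eigenvector psi on the path
   and lambda for its eigenvalue.  Pairing psi with a nonnegative test function
   supported on the path gives lambda >= d - O(1/n^2).  In a tree, induction on
   the height above the leaves shows that the value at a vertex is at most
   (1 + O(1/n^2)) / (d - 1) times the value at its parent, so that a leaf value
   is at most 2/n times the value at the root.  At a root the decay also forces
   an outward slope p_2 - p_1 >= (1/2 - O(1/n^2)) p_1, and as the second difference
   of p is at least -O(1/n^2) p, the growth stays linear, p_k >= k p_1 / 4, for
   k up to about n/5.  Hence p_1^2 n^3 = O(1) by the normalization; the leaf
   values are O(n^(-5/2)), with no logarithmic factor. *)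

Set Implicit Arguments.
Unset Strict Implicit.
Unset Printing Implicit Defensive.

Import Order.TTheory GRing.Theory Num.Theory.
Local Open Scope ring_scope.

(** * Real sequences: a test function, linear growth near the end of a path, powers close to 1 *)

Section RealSequences.
Variable R : realFieldType.
Implicit Types (p x : nat -> R) (n k m : nat).

(** The adjacency operator of a path with zero boundary values is self-adjoint. *)
Lemma sum_by_parts n p x :
  p 0 = 0 -> p n.+1 = 0 -> x 0 = 0 -> x n.+1 = 0 ->
  \sum_(k < n) x k.+1 * (p k + p k.+2) = \sum_(k < n) p k.+1 * (x k + x k.+2).
Proof.
move=> p0 pn x0 xn.
(* The partial sums differ only by boundary terms, which vanish at [m = n]. *)
suff H m : \sum_(k < m) x k.+1 * (p k + p k.+2) + p m * x m.+1 =
           \sum_(k < m) p k.+1 * (x k + x k.+2) + x m * p m.+1.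
  by have := H n; rewrite pn xn !mulr0 !addr0.
elim: m => [|m IH]; first by rewrite !big_ord0 p0 x0 !mul0r.
by rewrite !big_ord_recr /=; lra.
Qed.

(* A discrete stand-in for the sine: it vanishes together with its second
   difference (up to a positive constant) at t = 0 and t = n + 1. *)
Definition bump_fun n (k : nat) : R :=
  let N := n.+1%:R in let t := k%:R in t * (N - t) * (N ^+ 2 + N * t - t ^+ 2).

Lemma bump_fun_gt0 n k : (k < n)%N -> 0 < bump_fun n k.+1.
Proof.
move=> kn; rewrite /bump_fun.
have t0 : 0 < k.+1%:R :> R by rewrite ltr0n.
have tN : k.+1%:R < n.+1%:R :> R by rewrite ltr_nat.
by rewrite !mulr_gt0 ?subr_gt0 //; nra.
Qed.

(** With [u = t * (N - t)] the bump is [N^2 u + u^2]. Its second difference is exactly [2 - 12 u],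
    while [12 / N^2] times it is [12 u + 12 (u / N)^2]. *)
Lemma bump_fun_diff2 n k : (k < n)%N ->
  (2 - 12 / n.+1%:R ^+ 2) * bump_fun n k.+1 <= bump_fun n k + bump_fun n k.+2.
Proof.
move=> kn; rewrite /bump_fun.
have : 0 < k.+1%:R :> R by rewrite ltr0n.
have : k.+1%:R < n.+1%:R :> R by rewrite ltr_nat.
have -> : k%:R = k.+1%:R - 1 :> R by rewrite -natr1 addrK.
have -> : k.+2%:R = k.+1%:R + 1 :> R by rewrite natr1.
move: (n.+1%:R : R) (k.+1%:R : R) => N t tN t0.
have N0 : 0 < N by lra.
have -> : (2 - 12 / N ^+ 2) * (t * (N - t) * (N ^+ 2 + N * t - t ^+ 2)) =
  2 * (t * (N - t) * (N ^+ 2 + N * t - t ^+ 2)) - 12 * (t * (N - t))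
   - 12 * (t * (N - t) / N) ^+ 2.
  by field; rewrite gt_eqF.
have := sqr_ge0 (t * (N - t) / N); nra.
Qed.

(** Pair the inequality for [p] with the bump and move the second difference onto the bump; the
    positive pairing of the two then cancels. *)
Lemma positive_solution_eigenvalue_ge n p (s : R) :
  (0 < n)%N -> p 0 = 0 -> p n.+1 = 0 ->
  (forall k, (k < n)%N -> 0 < p k.+1) ->
  (forall k, (k < n)%N -> p k + p k.+2 <= s * p k.+1) ->
  2 - 12 / n.+1%:R ^+ 2 <= s.
Proof.
move=> n0 p0 pn ppos psup.
pose x := bump_fun n.
have x0 : x 0 = 0 by rewrite /x /bump_fun !mul0r.
have xn : x n.+1 = 0 by rewrite /x /bump_fun subrr mulr0 mul0r.
have S0 : 0 < \sum_(k < n) p k.+1 * x k.+1.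
  case: n n0 @x {p0 pn psup x0 xn} ppos => // n _ x ppos.
  rewrite big_ord_recl; apply: ltr_wpDr; last by rewrite mulr_gt0 ?ppos ?bump_fun_gt0.
  by apply: sumr_ge0 => i _; rewrite mulr_ge0 // ltW ?ppos ?bump_fun_gt0 ?ltn_ord.
rewrite -(ler_pM2r S0); apply: (@le_trans _ _ (\sum_(k < n) p k.+1 * (x k + x k.+2))).
  rewrite mulr_sumr; apply: ler_sum => k _.
  by rewrite mulrCA ler_wpM2l ?bump_fun_diff2 ?ltn_ord // ltW ?ppos ?ltn_ord.
rewrite -sum_by_parts // mulr_sumr; apply: ler_sum => k _.
by rewrite mulrA [leRHS]mulrC ler_wpM2l ?psup ?ltn_ord // ltW ?bump_fun_gt0 ?ltn_ord.
Qed.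

(** Each step lowers the slope by [mu * p], and the slope starts at [(1 / 2 - mu) * p 1] or more; it
    must stay at least [p 1 / 4]. *)
Lemma path_growth n p (mu : R) :
  (forall k, (k < n)%N -> 0 < p k.+1) ->
  mu <= 12 / n.+1%:R ^+ 2 ->
  (3 / 2 - mu) * p 1 <= p 2 <= (2 - mu) * p 1 ->
  (forall k, (k.+2 < n)%N -> p k.+1 + p k.+3 = (2 - mu) * p k.+2) ->
  forall k, (5 * k.+1 <= n.+1)%N -> k.+1%:R * p 1 / 4 <= p k.+1.
Proof.
move=> ppos muN /andP[p2l p2u] rec.
(* For negative [mu] the sequence is convex, so the slope never drops below [p 1 / 2]. *)
have [mu0|mu0] := ltP mu 0.
  have H k : (5 * k.+1 <= n.+1)%N -> p 1 / 2 <= p k.+2 - p k.+1.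
    elim: k => [|k IH] kn; first by have := ppos 0%N ltac:(lia); nra.
    have := rec k ltac:(lia); have := IH ltac:(lia).
    have := ppos k.+1 ltac:(lia); nra.
  elim=> [|k IH] kn; first by have := ppos 0%N ltac:(lia); nra.
  have := H k ltac:(lia); have := IH ltac:(lia); have := ppos 0%N ltac:(lia).
  by rewrite -[k.+2%:R]natr1; nra.
(* Concavity keeps the slope at most [p 1], hence [p] at most linear; so the accumulated loss of
   slope is at most [mu * p 1] times a triangular number. *)
have H k : (5 * k.+1 <= n.+1)%N ->
    [/\ p k.+1 <= k.+1%:R * p 1, p k.+2 - p k.+1 <= p 1
      & p 1 / 2 - mu * p 1 * (k.+1%:R * k.+2%:R / 2) <= p k.+2 - p k.+1].
  elim: k => [|k IH] kn.
    by have := ppos 0%N ltac:(lia); split; nra.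
  have := rec k ltac:(lia); have [] := IH ltac:(lia).
  have p10 := ppos 0%N ltac:(lia).
  have pk0 := ppos k.+1 ltac:(lia).
  have := mulr_ge0 mu0 (ltW pk0).
  have -> : k.+3%:R = k.+1%:R + 2 :> R by rewrite -(natrD _ _ 2) addn2.
  have -> : k.+2%:R = k.+1%:R + 1 :> R by rewrite natr1.
  move: (k.+1%:R : R) => t A B C D E.
  have pt : p k.+2 <= (t + 1) * p 1 by lra.
  have := ler_wpM2l mu0 pt.
  by split; lra.
have G k : (5 * k.+2 <= n.+1)%N -> p 1 / 4 <= p k.+2 - p k.+1.
  move=> kn; have [_ _ Hk] := H k ltac:(lia).
  apply: le_trans Hk.
  have p10 := ppos 0%N ltac:(lia).
  have M : mu * (k.+1%:R * k.+2%:R) <= 1 / 2.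
    have N0 : 0 < n.+1%:R ^+ 2 :> R by rewrite exprn_gt0 ?ltr0n.
    apply: (@le_trans _ _ (12 / n.+1%:R ^+ 2 * (k.+1%:R * k.+2%:R))).
      by rewrite ler_wpM2r ?mulr_ge0 ?ler0n.
    rewrite mulrAC ler_pdivrMr //.
    (* Staying in the first fifth gives [25 * k.+2 ^ 2 <= n.+1 ^ 2], and 24 < 25. *)
    suff : (24 * (k.+1 * k.+2) <= n.+1 ^ 2)%N.
      by rewrite -(ler_nat R) !natrM expr2; lra.
    by nia.
  have := ler_wpM2r (ltW p10) M; nra.
elim=> [|k IH] kn; first by have := ppos 0%N ltac:(lia); nra.
have := G k ltac:(lia); have := IH ltac:(lia).
by rewrite -[k.+2%:R]natr1; nra.
Qed.

Lemma sum_sqr_ge m : m%:R ^+ 3 / 3 <= \sum_(k < m) k.+1%:R ^+ 2 :> R.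
Proof.
elim: m => [|m IH]; first by rewrite big_ord0 expr0n mul0r.
rewrite big_ord_recr /=; have := ler0n R m.
by rewrite -[m.+1%:R]natr1; nra.
Qed.

(** Growth on the first [m] entries, about a fifth of the path, makes the sum of squares at least
    [p 1 ^ 2 * m ^ 3 / (16 * 3)]; [n <= 10 * m] supplies the other constant. *)
Lemma path_end_small n p (mu : R) : (10 <= n)%N ->
  (forall k, (k < n)%N -> 0 < p k.+1) ->
  mu <= 12 / n.+1%:R ^+ 2 ->
  (3 / 2 - mu) * p 1 <= p 2 <= (2 - mu) * p 1 ->
  (forall k, (k.+2 < n)%N -> p k.+1 + p k.+3 = (2 - mu) * p k.+2) ->
  \sum_(k < n) p k.+1 ^+ 2 <= 1 ->
  p 1 ^+ 2 * n%:R ^+ 3 <= 48 * 10 ^+ 3.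
Proof.
move=> n10 ppos muN p2 rec sum1.
have gr := path_growth ppos muN p2 rec.
set m := (n.+1 %/ 5)%N.
have mn : (m <= n)%N by rewrite /m; lia.
have nm : n%:R <= 10 * m%:R :> R by rewrite -natrM ler_nat /m; lia.
have : \sum_(k < m) (k.+1%:R * p 1 / 4) ^+ 2 <= 1.
  apply: le_trans sum1.
  rewrite -(big_mkord xpredT (fun k => p k.+1 ^+ 2)) (big_cat_nat (leq0n m) mn) //=.
  rewrite big_mkord ler_wpDr ?sumr_ge0 // => [k _|]; first exact: sqr_ge0.
  apply: ler_sum => k _; rewrite ler_sqr ?nnegrE.
  - by apply: gr; have := ltn_ord k; rewrite /m; lia.
  - by rewrite divr_ge0 ?mulr_ge0 ?ler0n // ltW ?ppos //; lia.
  - by rewrite ltW ?ppos //; have := ltn_ord k; lia.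
under eq_bigr do rewrite -mulrA exprMn.
rewrite -mulr_suml => S.
have := ler_wpM2r (sqr_ge0 (p 1 / 4)) (sum_sqr_ge m) => T.
have U : n%:R ^+ 3 <= (10 * m%:R) ^+ 3 :> R by rewrite lerXn2r ?nnegrE ?mulr_ge0 ?ler0n.
have := ler_wpM2l (sqr_ge0 (p 1)) U.
rewrite exprMn => V; apply: (le_trans V).
rewrite mulrCA mulrC ler_wpM2r ?exprn_ge0 ?ler0n //.
by move: S T; move: (\sum_(k < m) _) (m%:R ^+ 3) => s t S T; lra.
Qed.

(** The reflection sending [k] to [n + 1 - k] preserves the recurrence and swaps the ends. *)
Lemma path_end_small_rev n p (mu : R) : (10 <= n)%N ->
  (forall k, (k < n)%N -> 0 < p k.+1) ->
  mu <= 12 / n.+1%:R ^+ 2 ->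
  (3 / 2 - mu) * p n <= p n.-1 <= (2 - mu) * p n ->
  (forall k, (k.+2 < n)%N -> p k.+1 + p k.+3 = (2 - mu) * p k.+2) ->
  \sum_(k < n) p k.+1 ^+ 2 <= 1 ->
  p n ^+ 2 * n%:R ^+ 3 <= 48 * 10 ^+ 3.
Proof.
move=> n10 ppos muN pn rec sum1.
have := @path_end_small n (fun k => p (n.+1 - k)%N) mu n10.
rewrite !subSS subn0 subn1; apply=> //.
- move=> k kn; have -> : (n.+1 - k.+1 = (n - k.+1).+1)%N by lia.
  by apply: ppos; lia.
- move=> k kn; have -> : (n.+1 - k.+1 = (n - k.+3).+3)%N by lia.
  have -> : (n.+1 - k.+2 = (n - k.+3).+2)%N by lia.
  have -> : (n.+1 - k.+3 = (n - k.+3).+1)%N by lia.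
  by rewrite addrC rec //; lia.
- rewrite (reindex_inj rev_ord_inj) /= (eq_bigr (fun k : 'I_n => p k.+1 ^+ 2)) //.
  by move=> k _; congr (p _ ^+ 2); have := ltn_ord k; lia.
Qed.

Lemma exp1D_le2 (e : R) k : 0 <= e -> k%:R * e <= 1 / 2 -> (1 + e) ^+ k <= 2.
Proof.
move=> e0 ke.
(* This linear bound is inductive because [2 * j * e ^ 2 <= e]. *)
suff H j : (j <= k)%N -> (1 + e) ^+ j <= 1 + 2 * j%:R * e.
  by have := H k (leqnn k); lra.
elim: j => [|j IH] jk; first by rewrite expr0; lra.
have je : j%:R * e <= 1 / 2.
  by apply: le_trans ke; rewrite ler_wpM2r // ler_nat ltnW.
have := ler_wpM2l (ltac:(lra) : 0 <= 1 + e) (IH (ltnW jk)).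
have := ler_wpM2r e0 je.
by rewrite exprS -[j.+1%:R]natr1; lra.
Qed.

End RealSequences.

(** * Neighbour sums and degrees in the graph Q *)

Section NeighbourSums.
Variables (R : realFieldType) (d n ell : nat).
Local Notation V := (Qvertex d n ell).
Local Notation mult := (@Qmult d n ell).
Implicit Types (g : V -> R) (b : bool) (a : 'I_(d./2)) (w : seq 'I_d.-1).

Lemma sum_boolM (I : finType) (P : pred I) (F : I -> R) :
  \sum_i (P i)%:R * F i = \sum_(i | P i) F i.
Proof.
by rewrite [RHS]big_mkcond /=; apply: eq_bigr => i _; case: (P i); rewrite ?mul1r ?mul0r.
Qed.

(* The path is indexed from 1 here, with value 0 at the indices 0 and n + 1. *)
Definition path_val g (k : nat) : R := \sum_(j < n) (j.+1 == k)%:R * g (inl j).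

(* This is 0 when [w] is longer than [ell.-1], i.e. below the leaves. *)
Definition tree_val g b a w : R :=
  \sum_(y : ell.-1.-bseq 'I_d.-1) (y == w :> seq _)%:R * g (inr (b, (a, y))).

Definition root_pos b : nat := if b then n else 1.

(** The empty word addresses a child of the root, whose parent lies on the path; otherwise the
    parent's address drops the last letter. *)
Definition parent_val g b a w : R :=
  if w is c :: s then tree_val g b a (belast c s) else path_val g (root_pos b).

Lemma path_val_ord g (j : 'I_n) : path_val g j.+1 = g (inl j).
Proof. by rewrite /path_val sum_boolM (big_pred1 j). Qed.

Lemma path_val_out g k : (k == 0) || (n < k)%N -> path_val g k = 0.
Proof.
move=> kn; rewrite /path_val sum_boolM big_pred0 // => j.
by apply/negbTE; move: kn (ltn_ord j); lia.
Qed.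

Lemma tree_val_bseq g b a (y : ell.-1.-bseq 'I_d.-1) :
  tree_val g b a y = g (inr (b, (a, y))).
Proof. by rewrite /tree_val sum_boolM (big_pred1 y). Qed.

Lemma tree_val_below g b a w : (ell.-1 < size w)%N -> tree_val g b a w = 0.
Proof.
move=> lw; rewrite /tree_val sum_boolM big_pred0 // => y.
by apply: contraTF lw => /eqP <-; rewrite -leqNgt size_bseq.
Qed.

Lemma parent_val_rcons g b a w c :
  parent_val g b a (rcons w c) = tree_val g b a w.
Proof. by case: w => [|x w] //=; rewrite belast_rcons. Qed.

Lemma path_val_ge0 g k : (forall v, 0 <= g v) -> 0 <= path_val g k.
Proof. by move=> g0; apply: sumr_ge0 => *; rewrite mulr_ge0. Qed.

Lemma tree_val_ge0 g b a w : (forall v, 0 <= g v) -> 0 <= tree_val g b a w.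
Proof. by move=> g0; apply: sumr_ge0 => *; rewrite mulr_ge0. Qed.

Lemma sum_attached (F : bool * Qbranch d ell -> R) :
  \sum_x F x = \sum_b \sum_a \sum_y F (b, (a, y)).
Proof.
rewrite (eq_bigr (fun x => F (x.1, x.2))) => [|[] //].
rewrite -(pair_bigA _ (fun b x => F (b, x))); apply: eq_bigr => b _ /=.
rewrite (eq_bigr (fun x => F (b, (x.1, x.2)))) => [|[] //].
by rewrite -(pair_bigA _ (fun a y => F (b, (a, y)))).
Qed.

(** Zero padding of [path_val] lets inner and end vertices share one formula. *)
Lemma sum_Qmult_path g (i : 'I_n) :
  \sum_v (mult (inl i) v)%:R * g v =
  d./2%:R * (path_val g i + path_val g i.+2)
  + \sum_b (path_end b i)%:R * \sum_a tree_val g b a [::].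
Proof.
rewrite big_sumType /=; congr (_ + _); last first.
  rewrite sum_attached; apply: eq_bigr => b _.
  rewrite mulr_sumr; apply: eq_bigr => a _.
  rewrite /tree_val mulr_sumr; apply: eq_bigr => y _ /=.
  by rewrite /root_child size_eq0 mulrA -natrM mulnb.
rewrite /path_val -big_split mulr_sumr; apply: eq_bigr => j _ /=.
rewrite eqSS [i.+1 == j]eq_sym -mulrDl mulrA; congr (_ * _).
(* No vertex is both successor and predecessor of [i], so the disjunction in [Qmult] is a sum. *)
have [e1|_] := eqVneq (i.+1) j; have [e2|_] := eqVneq (j.+1) i;
  rewrite /= ?(mulr0, addr0, add0r, mulr1) //; lia.
Qed.

Lemma exists_rcons_left w w' :
  [exists c : 'I_d.-1, rcons w c == w']%:R = \sum_c (w' == rcons w c)%:R :> R.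
Proof.
case: existsP => [[c /eqP <-]|H].
  rewrite (bigD1 c) //= eqxx big1 ?addr0 // => c' /negbTE cc.
  by rewrite eqseq_rcons eqxx eq_sym cc.
rewrite big1 // => c _; case: eqP => // e.
by case: H; exists c; rewrite e.
Qed.

Lemma exists_rcons_right w c s :
  [exists x : 'I_d.-1, rcons w x == c :: s] = (w == belast c s).
Proof.
rewrite lastI; apply/existsP/eqP => [[x]|->]; last by exists (last c s).
by rewrite eqseq_rcons => /andP[/eqP].
Qed.

Lemma sum_Qmult_tree g b a (y : ell.-1.-bseq 'I_d.-1) : (0 < n)%N ->
  \sum_v (mult (inr (b, (a, y))) v)%:R * g v =
  parent_val g b a y + \sum_c tree_val g b a (rcons y c).
Proof.
move=> n0; rewrite big_sumType /=.
have -> : \sum_c tree_val g b a (rcons y c) =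
    \sum_(y' : ell.-1.-bseq _) [exists c, rcons y c == y']%:R * g (inr (b, (a, y'))).
  under eq_bigr do rewrite /tree_val.
  rewrite exchange_big /=; apply: eq_bigr => y' _.
  by rewrite -mulr_suml exists_rcons_left.
rewrite sum_attached (bigD1 b) //= [X in _ + (_ + X)]big1 ?addr0; last first.
  move=> b' /negbTE bb; apply: big1 => a' _; apply: big1 => y' _.
  by rewrite [b == b']eq_sym bb mul0r.
rewrite (bigD1 a) //= [X in _ + (_ + X)]big1 ?addr0; last first.
  move=> a' /negbTE aa; apply: big1 => y' _.
  by rewrite /tree_child /= aa [a == a']eq_sym aa /= andbF mul0r.
rewrite eqxx /tree_child /= eqxx /=.
(* A child of the root has its parent on the path; deeper down the parent is in the tree, and word
   lengths keep it distinct from the children. *)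
case E: (y : seq _) => [|c s] /=.
  congr (_ + _).
    rewrite /path_val; apply: eq_bigr => j _.
    rewrite /root_child /= E andbT /root_pos; congr ((_ : bool)%:R * _).
    by case: (b) => /=; have := ltn_ord j; lia.
  apply: eq_bigr => y' _; congr ((_ : bool)%:R * _).
  by apply/orb_idr => /existsP[x]; case: (y' : seq _).
rewrite big1 ?add0r => [|j _]; last by rewrite /root_child /= E andbF mul0r.
rewrite /tree_val -big_split; apply: eq_bigr => y' _ /=.
rewrite -mulrDl exists_rcons_right; congr (_ * _).
case: eqP => [->|_]; last by rewrite orbF add0r.
case: existsP => [[x /eqP/(congr1 size)]|_]; last by rewrite addr0.
by rewrite /= size_rcons size_belast; lia.
Qed.

(** The degree is the neighbour sum of the constant function 1, so the two formulas above give at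
    least [d] away from the leaves. *)
Lemma degree_lt_leaf (u : V) :
  (1 < n)%N -> (0 < d)%N -> ~~ odd d -> (degree mult u < d)%N ->
  exists b a (y : ell.-1.-bseq 'I_d.-1), u = inr (b, (a, y)) /\ size y = ell.-1.
Proof.
move=> n1 d0 dodd; rewrite -(ltr_nat R) /degree natr_sum.
pose g : V -> R := fun=> 1.
rewrite (eq_bigr (fun v => (mult u v)%:R * g v)) => [|v _]; last by rewrite mulr1.
have dE : d%:R = d./2%:R + d./2%:R :> R.
  by rewrite -natrD addnn even_halfK.
have g0 v : 0 <= g v by exact: ler01.
have T1 b a w : (size w <= ell.-1)%N -> tree_val g b a w = 1.
  by move=> sw; rewrite -[w]/(val (Bseq sw)) tree_val_bseq.
have P1 k : (k < n)%N -> path_val g k.+1 = 1.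
  by move=> kn; rewrite -[k]/(val (Ordinal kn)) path_val_ord.
case: u => [i|[b [a y]]].
  rewrite sum_Qmult_path.
  have A b : \sum_a tree_val g b a [::] = d./2%:R.
    rewrite (eq_bigr (fun=> 1)) => [|a _]; last exact: T1.
    by rewrite sumr_const card_ord.
  rewrite big_bool /= !A ltNge => /negP[].
  have h0 : 0 <= d./2%:R :> R by [].
  have := ltn_ord i.
  case: (i : nat) => [|k] kn.
    rewrite /= P1 // path_val_out // add0r mulr1 mul1r dE.
    by rewrite lerD2l lerDr mulr_ge0.
  rewrite (P1 k) ?(ltnW kn) // mul0r addr0.
  have [e|ne] := eqVneq k.+2 n.
    have -> : k.+1 == n.-1 by rewrite -e.
    rewrite mul1r dE mulrDr mulr1 lerD2r lerDl mulr_ge0 ?path_val_ge0 //.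
  rewrite P1; last by lia.
  by rewrite mulrDr mulr1 -dE lerDl mulr_ge0.
move=> H; exists b, a, y; split=> //.
apply/eqP; rewrite eqn_leq size_bseq leqNgt; apply/negP => sy; move: H.
rewrite sum_Qmult_tree; last by lia.
have -> : parent_val g b a y = 1.
  move: sy; case: (y : seq _) => [|c s] /= sy.
    case: b; last by rewrite P1 //; lia.
    by rewrite /= -[n]prednK ?P1 //; lia.
  by rewrite T1 // size_belast ltnW // ltnW.
rewrite (eq_bigr (fun=> 1)) => [|c _]; last by rewrite T1 // size_rcons.
by rewrite sumr_const card_ord -[1]/(1%:R) -natrD add1n prednK // ltxx.
Qed.

Lemma Qmult_sym (u v : V) : mult u v = mult v u.
Proof.
case: u v => [i|[b x]] [j|[b' y]] //=; first by rewrite orbC.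
by rewrite eq_sym orbC.
Qed.

End NeighbourSums.

(** * Estimates for a positive normalized eigenvector on Q *)

Section PositiveEigenvector.
Variables (R : realFieldType) (d n ell : nat).
Local Notation V := (Qvertex d n ell).
Local Notation mult := (@Qmult d n ell).
Variables (g : V -> R) (lambda : R).
Hypotheses (d4 : (4 <= d)%N) (dodd : ~~ odd d).
Hypothesis nd : (12 * d <= n)%N.
Hypothesis g_gt0 : forall v, 0 < g v.
Hypothesis g_eigen : forall u, lambda * g u = \sum_v (mult u v)%:R * g v.
Hypothesis g_norm : \sum_v g v ^+ 2 = 1.

Let h : R := d./2%:R.
Let q : R := d.-1%:R.
Let s : R := lambda / h.
Let p := path_val g.
Let T := tree_val g.

(** The upper bound for [d - lambda] given by the test function. *)
Let eta : R := h * (12 / n.+1%:R ^+ 2).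

(** At [lambda = d] the ratio [1 / q] solves [1 = r * (lambda - q * r)]; the factor [1 + eta]
    absorbs the defect of [lambda]. *)
Let rho : R := (1 + eta) / q.

Let n10 : (10 <= n)%N. Proof. by lia. Qed.
Let n_gt0 : (0 < n)%N. Proof. exact: leq_trans n10. Qed.
Let n1_gt0 : (0 < n.-1)%N. Proof. by rewrite -subn1 subn_gt0; exact: leq_trans n10. Qed.
Let h2 : 2 <= h. Proof. by rewrite /h ler_nat; lia. Qed.
Let h_gt0 : 0 < h. Proof. by have := h2; lra. Qed.
Let qE : q = 2 * h - 1.
Proof.
apply: (addIr 1); rewrite subrK /q /h -natrM natr1.
by rewrite prednK ?mul2n ?even_halfK //; lia.
Qed.
Let g_ge0 v : 0 <= g v. Proof. exact: ltW. Qed.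
Let lambdaE : lambda = h * s.
Proof. by rewrite /s mulrC divfK // gt_eqF. Qed.

Let p_gt0 k : (k < n)%N -> 0 < p k.+1.
Proof. by move=> kn; rewrite -[k]/(val (Ordinal kn)) /p path_val_ord. Qed.

Let p_first : p 0 = 0.
Proof. by rewrite /p path_val_out. Qed.

Let p_last : p n.+1 = 0.
Proof. by rewrite /p path_val_out // ltnSn orbT. Qed.

Let p_eigen k : (k < n)%N -> lambda * p k.+1 =
  h * (p k + p k.+2) + ((k == n.-1)%:R * \sum_a T true a [::]
                        + (k == 0)%:R * \sum_a T false a [::]).
Proof.
move=> kn; rewrite -[k]/(val (Ordinal kn)) /p path_val_ord g_eigen sum_Qmult_path.
by rewrite big_bool.
Qed.

Let sumT_ge0 b : 0 <= \sum_a T b a [::].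
Proof. by apply: sumr_ge0 => a _; rewrite tree_val_ge0. Qed.

Let s_ge : 2 - 12 / n.+1%:R ^+ 2 <= s.
Proof.
(* The tree terms at the two ends are nonnegative, so dropping them leaves the required
   inequality. *)
apply: (positive_solution_eigenvalue_ge (p := p)) => //.
move=> k kn; rewrite -(ler_pM2l h_gt0).
rewrite mulrA -lambdaE p_eigen // lerDl.
by rewrite addr_ge0 // mulr_ge0 // ler0n.
Qed.

Let lambda_ge : 2 * h - eta <= lambda.
Proof. by have := ler_wpM2l (ltW h_gt0) s_ge; rewrite mulrBr -lambdaE [h * 2]mulrC. Qed.

Let eta_ge0 : 0 <= eta.
Proof. by rewrite /eta mulr_ge0 ?divr_ge0 ?exprn_ge0 ?ler0n. Qed.

(** The left side is [6 * d / n.+1], which the threshold [12 * d <= n] controls. *)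
Let eta_le : n.+1%:R * eta <= 1 / 2.
Proof.
have N0 : 0 < n.+1%:R :> R by rewrite ltr0n.
have -> : n.+1%:R * eta = 12 * h / n.+1%:R.
  by rewrite /eta; field; rewrite gt_eqF.
rewrite ler_pdivrMr //.
have : (12 * d <= n.+1)%N by lia.
rewrite -(ler_nat R) natrM; have -> : d%:R = 2 * h.
  by rewrite /h -natrM mul2n even_halfK.
lra.
Qed.

Let eta_half : eta <= 1 / 2.
Proof.
apply: le_trans eta_le; rewrite -[leLHS]mul1r ler_wpM2r //.
by rewrite (ler_nat R 1).
Qed.

Let rho_ge0 : 0 <= rho.
Proof. by rewrite /rho divr_ge0 ?ler0n // addr_ge0. Qed.

Let rho_half : rho <= 1 / 2.
Proof. by rewrite /rho ler_pdivrMr qE; have := h2; have := eta_half; lra. Qed.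

(** Since [ell < n], the [ell] factors [1 + eta] multiply to at most 2. *)
Let rho_exp : n = (d.-1 ^ ell)%N -> rho ^+ ell <= 2 / n%:R.
Proof.
move=> nE; have n0 : 0 < n%:R :> R by rewrite ltr0n.
rewrite /rho expr_div_n nE natrX -/q ler_wpM2r ?invr_ge0 ?exprn_ge0 ?ler0n //.
apply: exp1D_le2 => //; apply: le_trans eta_le; rewrite ler_wpM2r // ler_nat.
by rewrite nE leqW // ltnW // ltn_expl // -ltnS prednK //; apply: leq_trans d4.
Qed.

Let rho_super : 1 <= rho * (lambda - q * rho).
Proof.
have q0 : q != 0 by rewrite gt_eqF // qE; have := h2; lra.
have -> : q * rho = 1 + eta by rewrite /rho mulrC divfK.
have q_gt0 : 0 < q by rewrite qE; have := h2; lra.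
rewrite /rho mulrAC ler_pdivlMr // mul1r.
(* This product exceeds [q] by [eta * (q - 2 - 2 * eta)], nonnegative as [q >= 3]. *)
apply: (@le_trans _ _ ((1 + eta) * (q - 2 * eta))).
  have := mulr_ge0 eta_ge0 (_ : 0 <= q - 2 - 2 * eta).
  by rewrite qE; have := h2; have := eta_half; lra.
by rewrite ler_wpM2l ?addr_ge0 // qE; have := lambda_ge; lra.
Qed.

Let tree_decay b a w : (size w <= ell.-1)%N -> T b a w <= rho * parent_val g b a w.
Proof.
(* Induction on the height above the leaves; a leaf has children of value 0 by the convention of
   [tree_val]. *)
have [m] := ubnP (ell.-1 - size w)%N; elim: m w => // m IH w lm lw.
have eqw : lambda * T b a w = parent_val g b a w + \sum_c T b a (rcons w c).
  rewrite -[w]/(val (Bseq lw)) {1}/T tree_val_bseq g_eigen sum_Qmult_tree //.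
have T0 : 0 <= T b a w by exact: tree_val_ge0.
have child c : T b a (rcons w c) <= rho * T b a w.
  have [lw'|lw'] := ltnP (size w) ell.-1.
    have := IH (rcons w c); rewrite parent_val_rcons; apply; rewrite size_rcons //.
    by rewrite subnS -ltnS prednK // subn_gt0.
  by rewrite /T tree_val_below ?size_rcons ?ltnS // mulr_ge0.
have : (lambda - q * rho) * T b a w <= parent_val g b a w.
  rewrite mulrBl lerBlDr eqw lerD2l.
  apply: le_trans (ler_sum _ (fun c _ => child c)) _.
  by rewrite sumr_const card_ord -[X in X <= _]mulr_natl mulrA.
move=> /(ler_wpM2l rho_ge0); apply: le_trans.
by rewrite mulrA -[leLHS]mul1r ler_wpM2r.
Qed.

Let tree_bound b a w :
  (size w <= ell.-1)%N -> T b a w <= rho ^+ (size w).+1 * p (root_pos n b).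
Proof.
elim/last_ind: w => [|w c IH] lw; first by rewrite expr1; exact: (tree_decay b a lw).
apply: le_trans (tree_decay b a lw) _; rewrite parent_val_rcons.
rewrite exprS -mulrA size_rcons ler_wpM2l ?IH //.
by move: lw; rewrite size_rcons => /ltnW.
Qed.

Let sumT_le b : \sum_a T b a [::] <= h * (rho * p (root_pos n b)).
Proof.
apply: (@le_trans _ _ (\sum_(a < d./2) rho * p (root_pos n b))).
  by apply: ler_sum => a _; exact: (@tree_decay b a [::] (leq0n _)).
by rewrite sumr_const card_ord -[leLHS]mulr_natl.
Qed.

Let p_norm : \sum_(k < n) p k.+1 ^+ 2 <= 1.
Proof.
rewrite -g_norm big_sumType /= -[leLHS]addr0 lerD //.
  by apply: ler_sum => k _; rewrite /p path_val_ord.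
by apply: sumr_ge0 => v _; exact: sqr_ge0.
Qed.

Let mu_le : 2 - s <= 12 / n.+1%:R ^+ 2.
Proof. by rewrite lerBlDl -lerBlDr. Qed.

Let p_inner k : (k.+2 < n)%N -> p k.+1 + p k.+3 = s * p k.+2.
Proof.
move=> kn; apply: (@mulfI _ h); first by rewrite gt_eqF.
rewrite mulrA -lambdaE p_eigen ?(ltnW kn) //.
rewrite ltn_eqF; last by rewrite -ltnS prednK.
by rewrite !mul0r !addr0.
Qed.

Let scale_le (x y : R) : (h * x <= h * y) = (x <= y).
Proof. by rewrite ler_pM2l. Qed.

Let root_small b : p (root_pos n b) ^+ 2 * n%:R ^+ 3 <= 48 * 10 ^+ 3.
Proof.
have pr0 : 0 < p (root_pos n b).
  by case: b; rewrite /= ?p_gt0 // -(prednK n_gt0) p_gt0 // prednK.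
(* The middle term is the contribution of the attached tree to the eigenvalue equation at its
   root. *)
have bnd : 0 <= h * s * p (root_pos n b) - h * (if b then p n.-1 else p 2)
      <= h * (rho * p (root_pos n b)).
  case: b pr0 => /= _.
    have -> : h * s * p n = h * (p n.-1 + p n.+1) + \sum_a T true a [::].
      rewrite -lambdaE -{1}(prednK n_gt0) p_eigen ?prednK //.
      by rewrite eqxx mul1r [_ == 0%N]gtn_eqF // mul0r addr0.
    rewrite p_last addr0 [_ + \sum_a _]addrC addrK.
    by rewrite sumT_ge0 /=; exact: (sumT_le true).
  have -> : h * s * p 1 = h * (p 0 + p 2) + \sum_a T false a [::].
    by rewrite -lambdaE p_eigen // ltn_eqF // mul0r add0r mul1r.
  rewrite p_first add0r [_ + \sum_a _]addrC addrK.
  by rewrite sumT_ge0 /=; exact: (sumT_le false).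
have {}bnd : (3 / 2 - (2 - s)) * p (root_pos n b) <= (if b then p n.-1 else p 2)
      <= (2 - (2 - s)) * p (root_pos n b).
  move: bnd; rewrite -mulrA -mulrBr pmulr_rge0 // scale_le => /andP[B1 B2].
  by have Q := ler_wpM2r (ltW pr0) rho_half; apply/andP; split; lra.
have E : 2 - (2 - s) = s by lra.
have inner k : (k.+2 < n)%N -> p k.+1 + p k.+3 = (2 - (2 - s)) * p k.+2.
  by move=> kn; rewrite p_inner // E.
case: b bnd {pr0} => /= bnd; first exact: path_end_small_rev inner p_norm.
exact: path_end_small inner p_norm.
Qed.

(** A leaf value is at most [2 / n] times the root value; squaring turns the exponent 5/2 into an
    integer. *)
Lemma leaf_small b a (y : ell.-1.-bseq 'I_d.-1) :
  n = (d.-1 ^ ell)%N -> size y = ell.-1 ->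
  g (inr (b, (a, y))) ^+ 2 * n%:R ^+ 5 <= (4 * 48)%:R * 10 ^+ 3.
Proof.
move=> nE sy; rewrite -tree_val_bseq -/T.
have n0 : 0 < n%:R :> R by rewrite ltr0n.
have ell0 : (0 < ell)%N.
  by case: (ell) nE => // n1; move: n10; rewrite n1.
have Tle : T b a y * n%:R <= 2 * p (root_pos n b).
  have pr0 : 0 <= p (root_pos n b) by exact: path_val_ge0.
  rewrite -ler_pdivlMr //; apply: le_trans (tree_bound b a (size_bseq y)) _.
  by rewrite sy prednK // mulrAC ler_wpM2r // rho_exp.
have T0 : 0 <= T b a y by exact: tree_val_ge0.
have Tn : (T b a y * n%:R) ^+ 2 <= (2 * p (root_pos n b)) ^+ 2.
  by rewrite lerXn2r ?nnegrE ?mulr_ge0 // path_val_ge0.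
have n3 : 0 <= n%:R ^+ 3 :> R by rewrite exprn_ge0 ?ler0n.
rewrite (_ : _ * _ = (T b a y * n%:R) ^+ 2 * n%:R ^+ 3); last by ring.
apply: le_trans (ler_wpM2r n3 Tn) _.
rewrite exprMn -mulrA (natrM _ 4 48) -[leRHS]mulrA -[2 ^+ 2]natrX.
by apply: ler_wpM2l (root_small b); rewrite ler0n.
Qed.

End PositiveEigenvector.

(** * From matrices to functions on vertices, and the final bound *)

Lemma Perron_eigenvector_equation (R : realType) (V : finType) (m : V -> V -> nat)
    (psi : 'rV[R]_#|V|) :
  (forall u v, m u v = m v u) -> Perron_eigenvector (adjmx m R) psi ->
  exists lambda, forall u, lambda * psi 0 (enum_rank u) =
    \sum_v (m u v)%:R * psi 0 (enum_rank v).
Proof.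
move=> msym [[lambda _ eig] _ _]; exists lambda => u.
have /matrixP/(_ 0 (enum_rank u)) := eig; rewrite !mxE => <-.
rewrite (reindex (@enum_rank V)) /=; last exact/onW_bij/enum_rank_bij.
by apply: eq_bigr => v _; rewrite mxE !enum_rankK msym mulrC.
Qed.

Theorem proposition5p3 (R : realType) :
  exists c : R, forall d : nat, (4 <= d)%N -> ~~ odd d ->
  exists (C : R) (N : nat), forall n ell : nat,
    n = (d.-1 ^ ell)%N -> (N <= n)%N ->
  forall psi : 'rV[R]_#|Qvertex d n ell|,
    Perron_eigenvector (adjmx (@Qmult d n ell) R) psi ->
  forall u : Qvertex d n ell, (degree (@Qmult d n ell) u < d)%N ->
    psi 0 (enum_rank u) <= C * ln n%:R `^ c * n%:R `^ (- (5 / 2)).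
Proof.
(* Exponent 0 means no logarithmic factor; the constant is the root of the one in [leaf_small], and
   only the threshold depends on [d]. *)
exists 0 => d d4 dodd; exists (Num.sqrt ((4 * 48)%:R * 10 ^+ 3)), (12 * d)%N.
move=> n ell nE nd psi Ppsi u /degree_lt_leaf.
have n1 : (1 < n)%N by apply: leq_trans nd; lia.
move=> /(_ R n1 (leq_trans (isT : 0 < 4)%N d4) dodd) [b [a [y [-> sy]]]].
have [lambda eig] := Perron_eigenvector_equation (@Qmult_sym d n ell) Ppsi.
case: Ppsi => _ pos nrm.
pose g (v : Qvertex d n ell) := psi 0 (enum_rank v).
have g0 v : 0 < g v by exact: pos.
have g1 : \sum_v g v ^+ 2 = 1.
  rewrite -(reindex (@enum_rank _) (F := fun i => psi 0 i ^+ 2) (P := xpredT)) /=.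
    rewrite -[LHS]sqr_sqrtr ?nrm ?expr1n //.
    by apply: sumr_ge0 => i _; exact: sqr_ge0.
  exact/onW_bij/enum_rank_bij.
have := leaf_small d4 dodd nd g0 eig g1 b a nE sy.
have n0 : 0 < n%:R :> R by rewrite ltr0n ltnW.
rewrite -ler_pdivlMr ?exprn_gt0 // => H.
rewrite powRr0 mulr1 -/(g _) -(ger0_norm (ltW (g0 _))) -sqrtr_sqr.
have -> : n%:R `^ (- (5 / 2)) = Num.sqrt ((n%:R ^+ 5)^-1) :> R.
  rewrite -powR_mulrn ?ler0n // -powRN -powR12_sqrt ?powR_ge0 // -powRrM.
  by congr (_ `^ _); lra.
rewrite -sqrtrM ?mulr_ge0 ?exprn_ge0 ?ler0n //; exact: ler_wsqrtr.
Qed.
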